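(* Let $n$ be a positive odd integer. Then, modulo $\Phi_n(q)^3$, \[ \sum_{k=0}^{(n-1)/2}[6k-1]\frac{(q^{-1};q^{4})_k(q^{-1};q^2)_k(q;q^2)_k^2}{(q^2;q^2)_k(q^{4};q^{4})_k(q^{2};q^{4})_k^2}\,q^{k^2+k+1} \equiv \begin{cases} -\dfrac{(q^{2} ; q^{4})_{(n-1)/4}}{(q^{4} ; q^{4})_{(n-1)/4}}\, q^{(n-1) / 4} ,& \text{if } n\equiv 1 \pmod{4}, \\[10pt] 0,& \text{if } n\equiv 3 \pmod{4}. \end{cases} \]
   Context: For an expression $x$ and a base $p$, $(x;p)_k=(1-x)(1-xp)\cdots(1-xp^{k-1})$ (with $(x;p)_0=1$). The $q$-integer is $[m]=(1-q^m)/(1-q)$ for any integer $m$. $\Phi_n(q)$ denotes the $n$-th cyclotomic polynomial in $q$. Two rational functions $A(q)$ and $B(q)$ are congruent modulo a polynomial $P(q)$ if $P(q)$ divides the numerator of the reduced form of $A(q)-B(q)$ in $\mathbb{Z}[q]$. *)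

(* Defs.v *)
From mathcomp Require Import all_boot all_order all_algebra all_field.

Set Implicit Arguments.
Unset Strict Implicit.
Unset Printing Implicit Defensive.

Import GRing.Theory.
Local Open Scope ring_scope.

Definition qpoch (F : fieldType) (x p : F) (k : nat) : F :=
  \prod_(i < k) (1 - x * p ^+ i).

Definition qint (F : fieldType) (q : F) (m : int) : F :=
  (1 - q ^ m) / (1 - q).

(* Frac(Z[q]) is Q(q). *)
Definition ratfun : fieldType := {fraction {poly int}}.

Definition embed (P : {poly int}) : ratfun := FracField.tofrac P.

Definition qvar : ratfun := embed 'X.

(* Divisibility in Z[q]. The library's "%|" on polynomials over int is
   pseudo-divisibility, which only amounts to divisibility in Q[q]. *)
Definition divides (P N : {poly int}) : Prop :=
  exists C : {poly int}, N = C * P.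

(* N / D is the reduced form of A: besides units, N and D have no common
   divisor in Z[q]. Such a pair is unique up to a common sign. *)
Definition reduced_form (A : ratfun) (N D : {poly int}) : Prop :=
  [/\ D != 0,
      A = embed N / embed D
    & forall C : {poly int}, divides C N -> divides C D ->
        C \is a GRing.unit].

Definition congr_mod (P : {poly int}) (A B : ratfun) : Prop :=
  exists N D : {poly int}, reduced_form (A - B) N D /\ divides P N.

(* Main.v *)
Require Import Defs.
From mathcomp Require Import all_boot all_order all_algebra all_field.
From mathcomp Require Import zify ring.
From Stdlib Require Import Classical.

Set Implicit Arguments.
Unset Strict Implicit.
Unset Printing Implicit Defensive.

Import GRing.Theory.
Local Open Scope ring_scope.

(* Replace (q;q^2)_k^2 and (q^2;q^4)_k^2 by (xq, q/x; q^2)_k and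
   (xq^2, q^2/x; q^4)_k. A WZ-type relation between the sums at x and x q^4
   evaluates the sum exactly at x = q^j for every odd j: it is the stated right
   hand side when j = 4m+1, and 0 when j = 4m+3. Clearing denominators, the
   difference between the sum and its value at x = q^n becomes a polynomial P in
   y = x + 1/x, of degree at most K = (n-1)/2. It vanishes at the node of q^n,
   and modulo Phi_n at the K nodes of q^j, j odd, j < n, because there the
   cleared denominator is divisible by Phi_n. By interpolation over the local
   ring of fractions regular at a primitive n-th root of unity,
   P(2) / (2 - q^n - q^-n) is divisible by Phi_n, and
   2 - q^n - q^-n = -(1 - q^n)^2 / q^n supplies the other factor Phi_n^2. *)

(** * Finite q-shifted factorials and their paired form in y = x + 1/x *)

Section Pochhammer.
Variable F : fieldType.
Implicit Types (x p : F) (k : nat).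

Lemma qpoch0 x p : qpoch x p 0 = 1.
Proof. by rewrite /qpoch big_ord0. Qed.

Lemma qpochS x p k : qpoch x p k.+1 = qpoch x p k * (1 - x * p ^+ k).
Proof. by rewrite /qpoch big_ord_recr. Qed.

(** Both sides are (x;p)_{k+1} times 1 or regrouped: the first or the last factor is split off. *)
Lemma qpoch_shift x p k :
  qpoch (x * p) p k * (1 - x) = qpoch x p k * (1 - x * p ^+ k).
Proof.
elim: k => [|k IH]; first by rewrite !qpoch0 expr0 mulr1.
by rewrite !qpochS mulrAC IH -mulrA -exprS.
Qed.

Lemma qpoch_neq0 x p k :
  (forall i, (i < k)%N -> x * p ^+ i != 1) -> qpoch x p k != 0.
Proof.
move=> h; apply/prodf_neq0 => i _.
by rewrite subr_eq0 eq_sym h.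
Qed.

Lemma qpoch_eq0 x p k i : (i < k)%N -> x * p ^+ i = 1 -> qpoch x p k = 0.
Proof.
move=> ik h; apply/eqP/prodf_eq0; exists (Ordinal ik) => //=.
by rewrite h subrr.
Qed.

(* In the variable y = x + 1/x, one has (1 - a x) (1 - a / x) = 1 + a^2 - a y. *)
Definition ypoch b p k : {poly F} :=
  \prod_(i < k) ((1 + (b * p ^+ i) ^+ 2)%:P - (b * p ^+ i) *: 'X).

Lemma horner_ypoch b p k x : x != 0 ->
  (ypoch b p k).[x + x^-1] = qpoch (x * b) p k * qpoch (b / x) p k.
Proof.
move=> x0; rewrite horner_prod /qpoch -big_split; apply: eq_bigr => i _ /=.
by rewrite !hornerE; field.
Qed.

Lemma ypochD b p k l : ypoch b p (k + l) = ypoch b p k * ypoch (b * p ^+ k) p l.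
Proof.
rewrite /ypoch big_split_ord /=; congr (_ * _); apply: eq_bigr => i _.
by rewrite exprD mulrA.
Qed.

Lemma size_ypoch b p k : (size (ypoch b p k) <= k.+1)%N.
Proof.
elim: k => [|k IH]; first by rewrite /ypoch big_ord0 size_poly1.
rewrite /ypoch big_ord_recr /=; apply: leq_trans (size_polyMleq _ _) _.
set s := (X in (_ + size X)%N).
suff : (size s <= 2)%N by move: IH; rewrite -/(ypoch b p k); lia.
rewrite (leq_trans (size_polyD _ _)) // geq_max size_polyN.
rewrite (leq_trans (size_polyC_leq1 _)) //=.
by rewrite (leq_trans (size_scale_leq _ _)) ?size_polyX.
Qed.

End Pochhammer.

(** * The sum with a parameter x, its WZ recurrence and its exact values *)

Section Sums.
Variables (F : fieldType) (q : F).

Definition scoef k : F :=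
  qpoch q^-1 (q ^+ 4) k * qpoch q^-1 (q ^+ 2) k /
  (qpoch (q ^+ 2) (q ^+ 2) k * qpoch (q ^+ 4) (q ^+ 4) k) *
  q ^+ (k ^ 2 + k + 1).

Definition xfactor (x : F) k : F :=
  qpoch (x * q) (q ^+ 2) k * qpoch (q / x) (q ^+ 2) k /
  (qpoch (x * q ^+ 2) (q ^+ 4) k * qpoch (q ^+ 2 / x) (q ^+ 4) k).

Definition sterm (x : F) k : F :=
  qint q (6%:Z * k%:Z - 1) * (scoef k * xfactor x k).

Lemma sterm_at1 k : sterm 1 k =
  qint q (6%:Z * k%:Z - 1) *
    (qpoch q^-1 (q ^+ 4) k * qpoch q^-1 (q ^+ 2) k * qpoch q (q ^+ 2) k ^+ 2 /
     (qpoch (q ^+ 2) (q ^+ 2) k * qpoch (q ^+ 4) (q ^+ 4) k *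
       qpoch (q ^+ 2) (q ^+ 4) k ^+ 2)) *
    q ^+ (k ^ 2 + k + 1).
Proof. by rewrite /sterm /scoef /xfactor !mul1r !divr1 !invfM; ring. Qed.

(** Over the common denominator [yden K], the k-th term keeps the factors of [yden K] of index at
    least k; these form the second [ypoch]. Each summand then has degree at most k + (K - k) = K. *)
Definition ynum K : {poly F} := \sum_(k < K.+1)
  (qint q (6%:Z * k%:Z - 1) * scoef k) *:
    (ypoch q (q ^+ 2) k * ypoch (q ^+ 2 * (q ^+ 4) ^+ k) (q ^+ 4) (K - k)).

Definition yden K : {poly F} := ypoch (q ^+ 2) (q ^+ 4) K.

Lemma size_ynum K : (size (ynum K) <= K.+1)%N.
Proof.
apply: (leq_trans (size_sum _ _ _)); apply/bigmax_leqP => k _.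
apply: (leq_trans (size_scale_leq _ _)); apply: leq_trans (size_polyMleq _ _) _.
have := size_ypoch q (q ^+ 2) k.
have := size_ypoch (q ^+ 2 * (q ^+ 4) ^+ k) (q ^+ 4) (K - k).
by have := ltn_ord k; lia.
Qed.

Hypothesis q0 : q != 0.
Hypothesis qn1 : forall k, (0 < k)%N -> q ^+ k != 1.

Lemma qint6E k : qint q (6%:Z * k%:Z - 1) = (1 - (q ^+ (2 * k)) ^+ 3 / q) / (1 - q).
Proof.
rewrite /qint; congr ((1 - _) / _).
rewrite expfzDr // exprN1 -exprM.
by rewrite -PoszM -exprnP; congr (q ^+ _ / _); rewrite mulnAC.
Qed.

Lemma scoefS k : let u := q ^+ (2 * k) in
  scoef k.+1 = scoef k *
   ((1 - u ^+ 2 / q) * (1 - u / q) / ((1 - q ^+ 2 * u) * (1 - q ^+ 4 * u ^+ 2))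
    * (u * q ^+ 2)).
Proof.
move=> u; rewrite /scoef !qpochS.
have e4 : (q ^+ 4) ^+ k = u ^+ 2 by rewrite /u -!exprM; congr (_ ^+ _); lia.
have e2 : (q ^+ 2) ^+ k = u by rewrite /u -!exprM.
have -> : q ^+ (k.+1 ^ 2 + k.+1 + 1) = q ^+ (k ^ 2 + k + 1) * (u * q ^+ 2).
  by rewrite /u -!exprD; congr (_ ^+ _); rewrite -!mulnn; lia.
rewrite e4 e2.
have qq i : (0 < i)%N -> 1 - q ^+ i != 0.
  by move=> i0; rewrite subr_eq0 eq_sym qn1.
have h1 : 1 - q ^+ 2 * u != 0 by rewrite /u -exprD qq.
have h2 : 1 - q ^+ 4 * u ^+ 2 != 0 by rewrite /u -exprM -exprD qq.
have p1 : qpoch (q ^+ 2) (q ^+ 2) k != 0.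
  by apply: qpoch_neq0 => i _; rewrite -exprM -exprD qn1.
have p2 : qpoch (q ^+ 4) (q ^+ 4) k != 0.
  by apply: qpoch_neq0 => i _; rewrite -exprM -exprD qn1.
by field; rewrite ?q0 ?h1 ?h2 ?p1 ?p2.
Qed.

(* No denominator of xfactor x k vanishes, nor does any 1 - x q^k with k > 0. *)
Definition generic x :=
  [/\ x != 0, forall k, (0 < k)%N -> x * q ^+ k != 1
    & forall k, x != q ^+ (2 + 4 * k)].

Lemma xfactor_den x k : generic x ->
  (qpoch (x * q ^+ 2) (q ^+ 4) k != 0) * (qpoch (q ^+ 2 / x) (q ^+ 4) k != 0).
Proof.
case=> x0 x1 x2; split; apply: qpoch_neq0 => i _.
  by rewrite -mulrA -exprM -exprD x1.
rewrite mulrAC -exprM -exprD; apply: contra (x2 i) => /eqP e.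
by rewrite -[q ^+ _](divfK x0) e mul1r.
Qed.

Lemma xfactorS x k : generic x -> let u := q ^+ (2 * k) in
  xfactor x k.+1 = xfactor x k * ((1 - x * q * u) * (1 - q * u / x) /
    ((1 - x * q ^+ 2 * u ^+ 2) * (1 - q ^+ 2 * u ^+ 2 / x))).
Proof.
move=> gx u; rewrite /xfactor.
have [d1 d2] := xfactor_den k.+1 gx.
have e4 : (q ^+ 4) ^+ k = u ^+ 2 by rewrite /u -!exprM; congr (_ ^+ _); lia.
have e2 : (q ^+ 2) ^+ k = u by rewrite /u -!exprM.
move: d1 d2; rewrite !qpochS e4 e2 !mulf_eq0 !negb_or.
rewrite ![_ / x * _]mulrAC.
move=> /andP[a1 a2] /andP[b1 b2].
rewrite -!mulrA !invfM !mulrA.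
ring.
Qed.

Lemma divqX_neq1 x i j : x != 0 -> x * q ^+ j != q ^+ i -> 1 - q ^+ i / (x * q ^+ j) != 0.
Proof.
move=> x0 h; rewrite subr_eq0 eq_sym; apply: contra h => /eqP e.
by rewrite -[q ^+ i](divfK (_ : x * q ^+ j != 0)) ?e ?mul1r // mulf_neq0 ?expf_neq0.
Qed.

(** Passing from x to x q^4 moves the numerator symbols by two steps of their base q^2 and the
    denominator symbols by one step of their base q^4, so six uses of [qpoch_shift] give the
    ratio. *)
Lemma xfactor_shift x k : generic x -> generic (x * q ^+ 4) ->
  let u := q ^+ (2 * k) in
  xfactor x k = xfactor (x * q ^+ 4) k *
    ((1 - x * q) * (1 - x * q ^+ 3) * (1 - u / (x * q ^+ 3)) * (1 - u / (x * q)) *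
     (1 - x * q ^+ 2 * u ^+ 2) * (1 - 1 / (x * q ^+ 2)) /
     ((1 - x * q * u) * (1 - x * q ^+ 3 * u) * (1 - 1 / (x * q ^+ 3)) *
      (1 - 1 / (x * q)) * (1 - x * q ^+ 2) * (1 - u ^+ 2 / (x * q ^+ 2)))).
Proof.
move=> gx gX u.
have e4 : (q ^+ 4) ^+ k = u ^+ 2 by rewrite /u -!exprM; congr (_ ^+ _); lia.
have e2 : (q ^+ 2) ^+ k = u by rewrite /u -!exprM.
have [dx1 dx2] := xfactor_den k gx; have [dX1 dX2] := xfactor_den k gX.
have [x0 x1 x2] := gx.
have xq i : (0 < i)%N -> 1 - x * q ^+ i != 0.
  by move=> i0; rewrite subr_eq0 eq_sym x1.
have xV i : (0 < i)%N -> 1 - 1 / (x * q ^+ i) != 0.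
  by move=> i0; apply: (@divqX_neq1 x 0 i) => //; rewrite expr0 x1.
have n1 := xq 1 isT; rewrite expr1 in n1.
have n2 := xq 2 isT; have n3 := xq 3 isT.
have v1 := xV 1 isT; rewrite expr1 in v1.
have v2 := xV 2 isT; have v3 := xV 3 isT.
have m1 : 1 - x * q * u != 0 by rewrite -mulrA -exprS xq.
have m3 : 1 - x * q ^+ 3 * u != 0 by rewrite -mulrA -exprD xq.
have m2 : 1 - x * q ^+ 2 * u ^+ 2 != 0 by rewrite -mulrA -exprM -exprD xq.
have s1 := qpoch_shift (x * q) (q ^+ 2) k.
have s3 := qpoch_shift (x * q ^+ 3) (q ^+ 2) k.
have b1 := qpoch_shift (1 / (x * q ^+ 3)) (q ^+ 2) k.
have b3 := qpoch_shift (1 / (x * q)) (q ^+ 2) k.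
have c1 := qpoch_shift (x * q ^+ 2) (q ^+ 4) k.
have c2 := qpoch_shift (1 / (x * q ^+ 2)) (q ^+ 4) k.
rewrite e2 in s1 s3 b1 b3; rewrite e4 in c1 c2.
rewrite /xfactor.
have E1 : x * q ^+ 3 = x * q * q ^+ 2 by ring.
have E2 : x * q ^+ 4 * q = x * q ^+ 3 * q ^+ 2 by ring.
have E3 : q / (x * q ^+ 4) = 1 / (x * q ^+ 3) by field; rewrite q0 x0.
have E4 : 1 / (x * q) = 1 / (x * q ^+ 3) * q ^+ 2 by field; rewrite q0 x0.
have E5 : q / x = 1 / (x * q) * q ^+ 2 by field; rewrite q0 x0.
have E6 : x * q ^+ 4 * q ^+ 2 = x * q ^+ 2 * q ^+ 4 by ring.
have E7 : q ^+ 2 / (x * q ^+ 4) = 1 / (x * q ^+ 2) by field; rewrite q0 x0.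
have E8 : q ^+ 2 / x = 1 / (x * q ^+ 2) * q ^+ 4 by field; rewrite q0 x0.
rewrite -E1 in s1; rewrite -E2 in s3; rewrite -E4 in b1; rewrite -E5 in b3.
rewrite -E6 in c1; rewrite -E8 in c2; rewrite E3 E7.
rewrite E7 in dX2.
have sol (a b s t : F) : s != 0 -> a * s = b * t -> a = b * t / s.
  by move=> nz <-; rewrite mulfK.
rewrite (sol _ _ _ _ m1 (esym s1)) (sol _ _ _ _ m3 (esym s3)).
rewrite (sol _ _ _ _ v1 b3) (sol _ _ _ _ v3 b1).
rewrite (sol _ _ _ _ m2 (esym c1)) (sol _ _ _ _ v2 c2).
rewrite ![1 / _ * u]mulrAC !mul1r [_^-1 * _ ^+ 2]mulrC.
rewrite !(invfM, invrK).
(* The four symbols left all belong to x q^4 and can be treated as atoms. *)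
move: (qpoch _ _ _) (qpoch _ _ _) (qpoch _ _ _) (qpoch _ _ _).
by move=> a b c d; ring.
Qed.

(* The WZ relation for the k-th terms divided by scoef k * xfactor (x q^4) k,
   with u = q^(2k); cert is the WZ certificate. *)
Lemma wz_rational (x u : F) : x != 0 -> 1 - q != 0 ->
  1 - q ^+ 2 * u != 0 -> 1 - q ^+ 4 * u ^+ 2 != 0 ->
  1 - x * q ^+ 6 * u ^+ 2 != 0 -> x * q ^+ 2 - u ^+ 2 != 0 ->
  1 - x * q * u != 0 -> 1 - x * q ^+ 3 * u != 0 -> 1 - x * q ^+ 5 * u != 0 ->
  1 - x * q != 0 -> 1 - x * q ^+ 2 != 0 -> 1 - x * q ^+ 3 != 0 ->
  let cert U := (1 - x ^+ 2 * q ^+ 4) * (1 - U) * (1 - U ^+ 2) *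
    (1 - x * q ^+ 2 * U ^+ 2) / ((1 - x * q * U) * (1 - x * q ^+ 3 * U)) / (1 - q) in
  (1 - x * q ^+ 3) * ((1 - u ^+ 3 / q) / (1 - q)) -
  q * (1 - x * q) * ((1 - u ^+ 3 / q) / (1 - q) *
   ((1 - x * q) * (1 - x * q ^+ 3) * (1 - u / (x * q ^+ 3)) * (1 - u / (x * q)) *
     (1 - x * q ^+ 2 * u ^+ 2) * (1 - 1 / (x * q ^+ 2)) /
     ((1 - x * q * u) * (1 - x * q ^+ 3 * u) * (1 - 1 / (x * q ^+ 3)) *
      (1 - 1 / (x * q)) * (1 - x * q ^+ 2) * (1 - u ^+ 2 / (x * q ^+ 2))))) =
  cert u - (1 - u ^+ 2 / q) * (1 - u / q) / ((1 - q ^+ 2 * u) * (1 - q ^+ 4 * u ^+ 2)) *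
     (u * q ^+ 2) *
   ((1 - x * q ^+ 4 * q * u) * (1 - q * u / (x * q ^+ 4)) /
    ((1 - x * q ^+ 4 * q ^+ 2 * u ^+ 2) * (1 - q ^+ 2 * u ^+ 2 / (x * q ^+ 4)))) *
    cert (u * q ^+ 2).
Proof.
move=> x0 h1 h2 h3 h4 h5 h6 h7 h8 h9 h10 h11 cert; rewrite /cert.
have e a b : b != 0 -> a = b -> a != 0 by move=> ? ->.
have eN (a : F) : 1 - a != 0 -> a - 1 != 0 by rewrite -opprB oppr_eq0.
field; rewrite h1 q0 x0 h5 h3 h2 h6 h10 !eN //= !andbT.
by apply/and3P; split; [apply: e h8 _ | apply: e h7 _ | apply: e h4 _]; ring.
Qed.

(** Summation telescopes the WZ relation. The lower boundary term vanishes through the factor 1 - U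
    of the certificate, as U = 1 for M = 0. *)
Lemma wz_sum x M : generic x -> generic (x * q ^+ 4) -> let U := q ^+ (2 * M) in
  (1 - x * q ^+ 3) * (\sum_(k < M) sterm (x * q ^+ 4) k) -
    q * (1 - x * q) * (\sum_(k < M) sterm x k) =
  - (scoef M * xfactor (x * q ^+ 4) M) *
  ((1 - x ^+ 2 * q ^+ 4) * (1 - U) * (1 - U ^+ 2) *
    (1 - x * q ^+ 2 * U ^+ 2) / ((1 - x * q * U) * (1 - x * q ^+ 3 * U)) / (1 - q)).
Proof.
move=> gx gX; elim: M => [|M IH] U.
  by rewrite !big_ord0 /U muln0 expr0 subrr !(mulr0, mul0r) subr0.
have qq i : (0 < i)%N -> 1 - q ^+ i != 0.
  by move=> i0; rewrite subr_eq0 eq_sym qn1.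
have [x0 x1 x2] := gx.
have xq i : (0 < i)%N -> 1 - x * q ^+ i != 0.
  by move=> i0; rewrite subr_eq0 eq_sym x1.
have := @wz_rational x (q ^+ (2 * M)) x0.
set u := q ^+ (2 * M) in IH *.
have -> : U = u * q ^+ 2 by rewrite /U /u -exprD mulnS addnC.
move=> wz; rewrite !big_ord_recr /=.
have -> (a b s t c d : F) : a * (s + c) - b * (t + d) = (a * s - b * t) + (a * c - b * d).
  by ring.
rewrite IH scoefS (xfactorS _ gX) /sterm (xfactor_shift _ gx gX) qint6E -/u.
(* Equality here would give x q^4 = q^(2 + 4M), which genericity of x q^4 excludes. *)
have h5 : x * q ^+ 2 - u ^+ 2 != 0.
  have [_ _ gX3] := gX; apply/eqP => /subr0_eq e.
  have /eqP[] := gX3 M.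
  transitivity (x * q ^+ 2 * q ^+ 2); first by ring.
  by rewrite e mulrC /u -exprM -exprD mulnAC.
have {}wz := wz (qq 1 isT) ltac:(by rewrite /u -exprD qq)
  ltac:(by rewrite /u -exprM -exprD qq)
  ltac:(by rewrite /u -mulrA -exprM -exprD xq)
  h5
  ltac:(by rewrite /u -mulrA -exprS xq) ltac:(by rewrite /u -mulrA -exprD xq)
  ltac:(by rewrite /u -mulrA -exprD xq) (xq 1 isT) (xq 2 isT) (xq 3 isT).
(* The WZ relation is multiplied by t T, where t is [scoef M] and T is [xfactor] at x q^4; R is the
   ratio from [xfactor_shift], and s, y are the ratios of consecutive [scoef] and [xfactor]. *)
have comb (a b A R G0 G1 s y t T : F) : a * A - b * (A * R) = G0 - s * y * G1 ->
  - (t * T) * G0 + (a * (A * (t * T)) - b * (A * (t * (T * R)))) = - (t * s * (T * y)) * G1.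
  move=> h; have -> : G0 = a * A - b * (A * R) + s * y * G1 by rewrite h subrK.
  by ring.
exact: comb wz.
Qed.

Lemma expq_eq i j : q ^+ i = q ^+ j -> i = j.
Proof.
wlog le_ij : i j / (i <= j)%N => [h e|].
  by have [/h/(_ e)|/ltnW ji] := leqP i j; last exact: esym (h _ _ ji (esym e)).
move=> /eqP; rewrite -(subnK le_ij) exprD -[X in X == _]mul1r.
rewrite (inj_eq (mulIf (expf_neq0 _ q0))) => e; have [//|] := posnP (j - i)%N.
  by move->.
by move=> /qn1; rewrite eq_sym e.
Qed.

Lemma generic_odd i : generic (q ^+ (2 * i + 1)).
Proof.
split=> [|k k0|k]; first exact: expf_neq0.
  by rewrite -exprD qn1 // addn_gt0 k0 orbT.
by apply/eqP => /expq_eq; lia.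
Qed.

(** The factor of index i in (q/x; q^2)_k is 1 - q^(-2i) q^(2i). Hence the sum at x = q^(2i+1) stops
    after k = i. *)
Lemma xfactor_eq0 i k : (i < k)%N -> xfactor (q ^+ (2 * i + 1)) k = 0.
Proof.
move=> ik; rewrite /xfactor (_ : qpoch (q / _) _ k = 0) ?mulr0 ?mul0r //.
apply: (qpoch_eq0 ik); rewrite mulrAC -exprM -exprS -addn1 divff //.
exact: expf_neq0.
Qed.

Lemma sterm0 x : sterm x 0 = -1.
Proof.
rewrite /sterm qint6E muln0 expr0 /scoef /xfactor !qpoch0 expr1n.
have h : 1 - q != 0 by rewrite subr_eq0 eq_sym -(expr1 q) qn1.
by field; rewrite h q0 oner_neq0.
Qed.

(** The boundary term of [wz_sum] contains [xfactor] at q^(2i+5), which is zero once M exceeds i +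
    2; a two-term recurrence in x remains. *)
Lemma sum_sterm_shift i M : (i.+2 < M)%N ->
  (1 - q ^+ (2 * i + 4)) * (\sum_(k < M) sterm (q ^+ (2 * i.+2 + 1)) k) =
  q * (1 - q ^+ (2 * i + 2)) * (\sum_(k < M) sterm (q ^+ (2 * i + 1)) k).
Proof.
move=> iM; have gX := generic_odd i.+2.
have e : q ^+ (2 * i.+2 + 1) = q ^+ (2 * i + 1) * q ^+ 4.
  by rewrite -exprD; congr (_ ^+ _); lia.
rewrite e in gX; have := wz_sum M (generic_odd i) gX.
rewrite -e xfactor_eq0 // mulr0 oppr0 /= mul0r => /subr0_eq.
have -> : q ^+ (2 * i + 1) * q ^+ 3 = q ^+ (2 * i + 4) by rewrite -exprD -addnA.
have -> : q ^+ (2 * i + 1) * q = q ^+ (2 * i + 2)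
  by rewrite -exprSr; congr (_ ^+ _); lia.
by [].
Qed.

(** At x = q only the term k = 0, equal to -1, survives. Each step from x to x q^4 contributes q (1
    - q^(4m+2)) / (1 - q^(4m+4)), the ratio of consecutive right-hand sides. *)
Lemma sum_sterm1 m M : (2 * m < M)%N ->
  \sum_(k < M) sterm (q ^+ (4 * m + 1)) k =
  - (qpoch (q ^+ 2) (q ^+ 4) m / qpoch (q ^+ 4) (q ^+ 4) m) * q ^+ m.
Proof.
elim: m => [|m IH] mM.
  case: M mM => // M _; rewrite big_ord_recl big1 => [|i _].
    by rewrite sterm0 !qpoch0 expr0 divr1 mulr1 addr0.
  by rewrite /sterm (xfactor_eq0 (i := 0)) ?mulr0.
have := @sum_sterm_shift (2 * m) M; rewrite mulnA -[(2 * 2)%N]/4%N => h.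
have -> : (4 * m.+1 + 1 = 2 * (2 * m).+2 + 1)%N by lia.
have nz i : 1 - q ^+ i.+1 != 0 by rewrite subr_eq0 eq_sym qn1.
apply: (mulfI (nz (4 * m + 3)%N)).
have {}h := h ltac:(lia); rewrite -addnS h IH; last by lia.
rewrite !qpochS -!exprM -!exprD.
have p : qpoch (q ^+ 4) (q ^+ 4) m != 0.
  by apply: qpoch_neq0 => i _; rewrite -exprM -exprD qn1.
rewrite ![(_ + 4 * m)%N]addnC (exprS q m).
have := nz (4 * m + 3)%N; rewrite -addnS.
move: (1 - q ^+ (4 * m + 4)) (1 - q ^+ (4 * m + 2)) p => a b p a0.
by field; rewrite p a0.
Qed.

(** At x = q^3 only the terms k = 0 and k = 1 survive, and they cancel. The recurrence carries the
    zero on, since 1 - q^(4m+6) is not zero. *)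
Lemma sum_sterm3 m M : (2 * m + 1 < M)%N ->
  \sum_(k < M) sterm (q ^+ (4 * m + 3)) k = 0.
Proof.
elim: m => [|m IH] mM.
  case: M mM => [|[|M]] // _; rewrite !big_ord_recl big1 => [|i _]; last first.
    by rewrite /sterm (xfactor_eq0 (i := 1)) ?mulr0.
  rewrite sterm0 addr0 /= /sterm.
  have g := generic_odd 1.
  have nz i : 1 - q ^+ i.+1 != 0 by rewrite subr_eq0 eq_sym qn1.
  rewrite /bump /= qint6E (scoefS 0) (xfactorS 0 g) /scoef /xfactor !qpoch0.
  rewrite !(addn0, muln0, muln1, expr0, expr1n) -[(2 * 1 + 1)%N]/3%N.
  have n1 := nz 0; rewrite expr1 in n1.
  field; rewrite q0 -opprB oppr_eq0 n1 oner_neq0 -exprD.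
  by rewrite (nz 4) (nz 3) (nz 1).
have := @sum_sterm_shift (2 * m + 1) M.
have -> : (2 * (2 * m + 1).+2 + 1 = 4 * m.+1 + 3)%N by lia.
have -> : (2 * (2 * m + 1) + 1 = 4 * m + 3)%N by lia.
rewrite IH ?mulr0; last by lia.
move=> /(_ ltac:(lia)) /eqP; rewrite mulf_eq0 => /orP[|/eqP //].
by rewrite subr_eq0 eq_sym (negPf (qn1 _)) //; lia.
Qed.

Lemma horner_ynum K x : generic x ->
  (ynum K).[x + x^-1] = (\sum_(k < K.+1) sterm x k) * (yden K).[x + x^-1].
Proof.
move=> gx; have [x0 _ _] := gx.
rewrite horner_sum mulr_suml; apply: eq_bigr => k _.
have kK : (k <= K)%N by rewrite -ltnS.
have -> : yden K = ypoch (q ^+ 2) (q ^+ 4) (k + (K - k)) by rewrite subnKC.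
rewrite ypochD !hornerZ !hornerM.
have [d1 d2] := xfactor_den k gx.
rewrite /sterm /xfactor -!horner_ypoch // in d1 d2 *.
have d : (ypoch (q ^+ 2) (q ^+ 4) k).[x + x^-1] != 0.
  by rewrite horner_ypoch // mulf_neq0.
by move: (_.[_]) (_.[_]) (_.[_]) d => a b c d; field.
Qed.

End Sums.

(** * Interpolation with values in an ideal [I] over a ring [L] *)

Section Interpolation.
Variables (F : fieldType) (L I : F -> Prop).
Hypothesis LM : forall a b, L a -> I b -> I (a * b).
Hypothesis ID : forall a b, I a -> I b -> I (a + b).
Hypothesis IB : forall a b, I a -> I b -> I (a - b).
Hypothesis I0 : I 0.

Lemma newton_step (p : {poly F}) a : exists2 r : {poly F},
  size r = (size p).-1 & p = (p.[a])%:P + r * ('X - a%:P).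
Proof.
have /factor_theorem[r e] : root (p - (p.[a])%:P) a.
  by rewrite rootE !hornerE subrr.
have [p1|p1] := leqP (size p) 1.
  exists 0; first by rewrite size_poly0; case: size p1 => [|[]].
  by rewrite mul0r addr0 (size1_polyC p1) hornerC.
exists r; last by rewrite -e addrC subrK.
have : size (r * ('X - a%:P)) = size p.
  by rewrite -e size_polyDl // size_polyN (leq_ltn_trans (size_polyC_leq1 _)).
have [->|r0] := eqVneq r 0; first by rewrite mul0r size_poly0 => <-.
by rewrite size_Mmonic ?monicXsubC // size_XsubC addn2 => <-.
Qed.

(** Newton interpolation: splitting off the last node leaves a quotient of smaller size, whose
    values at the other nodes are divided differences. These stay in [I] because differences of
    nodes have inverses in [L]. *)
Lemma interpolation_ideal m (y : nat -> F) (p : {poly F}) z :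
  (forall i j, (i < j < m)%N -> y i != y j /\ L (y i - y j)^-1) ->
  (forall i, (i < m)%N -> L (z - y i)) ->
  (size p <= m)%N -> (forall i, (i < m)%N -> I p.[y i]) -> I p.[z].
Proof.
elim: m p => [|m IH] p hy hz sp hp.
  by move: sp; rewrite leqn0 size_poly_eq0 => /eqP->; rewrite horner0.
have [r sr e] := newton_step p (y m).
rewrite e !hornerE; apply: ID; first exact: hp.
rewrite mulrC; apply: LM; first exact: hz.
apply: IH => [i j /andP[ij jm]|i im||i im].
- by apply: hy; rewrite ij ltnS ltnW.
- by apply: hz; rewrite ltnS ltnW.
- by rewrite sr; lia.
have [yi Li] := hy i m ltac:(by rewrite im /=).
have -> : r.[y i] = (y i - y m)^-1 * (p.[y i] - p.[y m]).
  rewrite {1}e !hornerE [_ + _ * _]addrC addrK mulrC mulfK //.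
  by rewrite subr_eq0.
by apply: LM => //; apply: IB; apply: hp; rewrite ?ltnS // ltnW.
Qed.

End Interpolation.

Lemma inv_sum_sub (F : fieldType) (w d : F) : w != 0 -> d != 0 ->
  w + w^-1 - (w * d + (w * d)^-1) = - ((1 - d) * (1 - w ^+ 2 * d) / (w * d)).
Proof. by move=> w0 d0; field; rewrite w0 d0. Qed.

Lemma two_sub_inv_sum (F : fieldType) (w : F) : w != 0 ->
  1 + 1 - (w + w^-1) = - (1 - w) * (1 - w) / w.
Proof. by move=> w0; field. Qed.

(* These two numbers are even, with sum 2 (2 K + 1), which is 2 mod 4. *)
Lemma two_mod4 i K : (i <= K)%N ->
  {l | (2 * (K - i) = 4 * l + 2)%N} + {l | (2 * (K + i + 1) = 4 * l + 2)%N}.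
Proof.
move=> iK; have [o|o] := boolP (odd (K - i)).
  by left; exists ((K - i)./2); have := odd_double_half (K - i); rewrite o; lia.
right; exists ((K + i)./2); have := odd_double_half (K + i).
by rewrite oddD -oddB // (negbTE o); lia.
Qed.

Lemma half_cases i : {j | i = (2 * j)%N} + {j | i = (2 * j + 1)%N}.
Proof.
have := odd_double_half i; case: (odd i) => e; [right|left]; exists i./2; lia.
Qed.

(** * Divisibility by Phi_n in Z[q] and reduced forms *)

Section Local.
Variables (n : nat) (z : algC).
Hypothesis prim_z : n.-primitive_root z.

Definition zeval (N : {poly int}) : algC := (map_poly intr N).[z].

Lemma zevalM M N : zeval (M * N) = zeval M * zeval N.
Proof. by rewrite /zeval rmorphM hornerM. Qed.

Lemma zevalD M N : zeval (M + N) = zeval M + zeval N.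
Proof. by rewrite /zeval rmorphD hornerD. Qed.

Lemma zeval1BX k : zeval (1 - 'X^k) = 1 - z ^+ k.
Proof. by rewrite /zeval rmorphB rmorph1 /= map_polyXn !hornerE. Qed.

Lemma zeval_Phi : zeval 'Phi_n = 0.
Proof.
rewrite /zeval; apply/eqP; rewrite -rootE.
by rewrite (Cintr_Cyclotomic prim_z) -(minCpoly_cyclotomic prim_z) root_minCpoly.
Qed.

(** Phi_n is monic, so division with remainder works over Z. The remainder vanishes at z and has
    smaller degree than the minimal polynomial of z over Q, hence is zero. *)
Lemma divides_Phi N : zeval N = 0 -> divides 'Phi_n N.
Proof.
move=> N0; have mP := Cyclotomic_monic n.
have e := Pdiv.RingMonic.rdivp_eq mP N.
set r := Pdiv.CommonRing.rmodp N 'Phi_n in e.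
exists (Pdiv.CommonRing.rdivp N 'Phi_n); rewrite {1}e.
suff -> : r = 0 by rewrite addr0.
have r0 : zeval r = 0 by move: N0; rewrite e zevalD zevalM zeval_Phi mulr0 add0r.
have sr : (size r < size 'Phi_n)%N by rewrite Pdiv.Ring.ltn_rmodp monic_neq0.
have [p [ep mp] hp] := minCpolyP z.
have sp : size p = size 'Phi_n.
  rewrite -(size_map_poly (@ratr algC)) -ep (minCpoly_cyclotomic prim_z).
  by rewrite size_cyclotomic size_Cyclotomic.
have : p %| map_poly (intr : int -> rat) r.
  rewrite -hp -map_poly_comp /root.
  by rewrite (eq_map_poly (fun x => ratr_int _ x)) -/(zeval r) r0.
have injr : injective (intr : int -> rat) by exact: intr_inj.
have rE : size (map_poly (intr : int -> rat) r) = size r.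
  by apply: size_map_inj_poly.
move/(dvdp_leq _) => h; apply/eqP; apply: contraTT sr => rn0.
rewrite -leqNgt -sp -rE h // -size_poly_eq0 rE size_poly_eq0 //.
Qed.

(** Phi_n is prime and does not divide C, as C does not vanish at z; its powers are removed from N
    one at a time. *)
Lemma divides_Phi_cancel e N C :
  zeval C != 0 -> divides ('Phi_n ^+ e) (N * C) -> divides ('Phi_n ^+ e) N.
Proof.
move=> C0; elim: e N => [|e IH] N [M eM]; first by exists N; rewrite mulr1.
have /divides_Phi[N' eN] : zeval N = 0.
  have /eqP := zevalM N C; rewrite eM exprS mulrCA zevalM zeval_Phi mul0r.
  by rewrite eq_sym mulf_eq0 (negPf C0) orbF => /eqP.
have P0 : 'Phi_n != 0 :> {poly int} by rewrite monic_neq0 ?Cyclotomic_monic.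
have [|M' eM'] := IH N'.
  by exists M; apply: (mulIf P0); rewrite -[RHS]mulrA -exprSr -eM eN mulrAC.
by exists M'; rewrite eN eM' -mulrA -exprSr.
Qed.

(** Termination measure for cancelling common factors: a non-unit factor of positive degree raises
    the size, and a constant one, not being 1 or -1, raises the absolute value of the leading
    coefficient. *)
Definition pmeasure (D : {poly int}) : nat := size D + `|lead_coef D|.

Lemma pmeasureM (D C : {poly int}) : D * C != 0 -> C \isn't a GRing.unit ->
  (pmeasure D < pmeasure (D * C))%N.
Proof.
rewrite mulf_eq0 negb_or => /andP[D0 C0] Cu.
rewrite /pmeasure lead_coefM abszM size_mul //.
have lD : (0 < `|lead_coef D|)%N by rewrite absz_gt0 lead_coef_eq0.
have lC : (0 < `|lead_coef C|)%N by rewrite absz_gt0 lead_coef_eq0.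
have sD : (0 < size D)%N by rewrite size_poly_gt0.
have sC : (0 < size C)%N by rewrite size_poly_gt0.
have [sC1|sC1] := leqP (size C) 1; last first.
  by move: sC1 sC sD lD lC; move: (size _) (size _) (absz _) (absz _); nia.
have {sC1 sC} e : size C = 1%N by apply/eqP; rewrite eqn_leq sC1.
suff : (1 < `|lead_coef C|)%N.
  by rewrite e; move: sD lD; move: (size _) (absz _) (absz _); nia.
rewrite ltn_neqAle lC andbT eq_sym; apply: contra Cu => l1.
rewrite poly_unitE e eqxx /=.
move: l1; rewrite lead_coefE e /=.
by case: (C`_0) => [[|[|]]|[|]].
Qed.

(** Common non-unit divisors are cancelled until none is left. Each divides D, so it does not vanish
    at z, and its removal costs N no factor Phi_n. *)
Lemma local_reduced_form e A (N D : {poly int}) : zeval D != 0 ->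
  divides ('Phi_n ^+ e) N -> A = embed N / embed D ->
  exists N' D', reduced_form A N' D' /\ divides ('Phi_n ^+ e) N'.
Proof.
move: {2}(pmeasure D).+1 (ltnSn (pmeasure D)) => m.
elim: m N D => // m IH N D lt_m D0 PN eA.
have Dn0 : D != 0.
  by apply: contra D0 => /eqP->; rewrite /zeval rmorph0 horner0.
have [|] := classic (exists C : {poly int},
  [/\ divides C N, divides C D & C \isn't a GRing.unit]); last first.
  move=> nC; exists N, D; split=> //; split=> // C CN CD.
  by apply: contraT => Cu; case: nC; exists C.
move=> [C [[N' eN] [D' eD] Cu]].
have C0 : C != 0 by apply: contraNneq Dn0 => C0; rewrite eD C0 mulr0.
have : zeval C != 0 /\ zeval D' != 0.
  by move: D0; rewrite eD zevalM mulf_eq0 negb_or => /andP[].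
move=> [zC zD']; apply: (IH N' D') => //.
- by rewrite -ltnS; apply: leq_trans lt_m; rewrite ltnS eD pmeasureM // -eD.
- by apply: (divides_Phi_cancel zC); rewrite -eN.
rewrite eA eN eD /embed !rmorphM /= -mulf_div divff ?mulr1 //.
by rewrite tofrac_eq0.
Qed.

(** * The local ring at z and the powers of its maximal ideal *)

Local Notation Phi := ('Phi_n).

(** [loc 0] is the ring of rational functions regular at z, and [loc e] the e-th power of its
    maximal ideal, which Phi_n generates. *)
Definition loc e (A : ratfun) : Prop := exists N D : {poly int},
  zeval D != 0 /\ A = embed (N * Phi ^+ e) / embed D.

Lemma embedM : {morph embed : M N / M * N}. Proof. exact: tofracM. Qed.
Lemma embedD : {morph embed : M N / M + N}. Proof. exact: tofracD. Qed.
Lemma embedXn k : {morph embed : M / M ^+ k}. Proof. exact: tofracXn. Qed.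

Lemma embed_neq0 D : zeval D != 0 -> embed D != 0.
Proof.
by apply: contra; rewrite tofrac_eq0 => /eqP->; rewrite /zeval rmorph0 horner0.
Qed.

Lemma loc_zero e : loc e 0.
Proof.
exists 0, 1; rewrite mul0r /embed tofrac0 mul0r; split=> //.
by rewrite /zeval rmorph1 hornerC oner_neq0.
Qed.

Lemma locM e f A B : loc e A -> loc f B -> loc (e + f) (A * B).
Proof.
move=> [N [D [D0 ->]]] [N' [D' [D0' ->]]]; exists (N * N'), (D * D').
split; first by rewrite zevalM mulf_neq0.
by rewrite mulf_div -!embedM exprD mulrACA.
Qed.

Lemma locD e A B : loc e A -> loc e B -> loc e (A + B).
Proof.
move=> [N [D [D0 ->]]] [N' [D' [D0' ->]]]; exists (N * D' + N' * D), (D * D').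
split; first by rewrite zevalM mulf_neq0.
rewrite addf_div ?embed_neq0 // -!embedM -embedD; congr (embed _ / _); ring.
Qed.

Lemma loc_embed N : loc 0 (embed N).
Proof.
exists N, 1; rewrite mulr1 /embed tofrac1 divr1; split=> //.
by rewrite /zeval rmorph1 hornerC oner_neq0.
Qed.

Lemma loc_embedV N : zeval N != 0 -> loc 0 (embed N)^-1.
Proof. by move=> N0; exists 1, N; rewrite mulr1 /embed tofrac1 div1r. Qed.

Lemma loc1 : loc 0 1.
Proof. by rewrite -[1]tofrac1; exact: loc_embed. Qed.

Lemma locN e A : loc e A -> loc e (- A).
Proof.
move=> lA; rewrite -mulN1r; apply: (@locM 0) lA.
by rewrite -tofrac1 -tofracN; exact: loc_embed.
Qed.

Lemma locB e A B : loc e A -> loc e B -> loc e (A - B).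
Proof. by move=> lA lB; apply: locD => //; apply: locN. Qed.

Local Notation q := qvar.

Lemma qvarX k : q ^+ k = embed 'X^k.
Proof. by rewrite embedXn. Qed.

Lemma qvar_neq0 : q != 0.
Proof. by rewrite tofrac_eq0 polyX_eq0. Qed.

Lemma qvarX_neq1 k : (0 < k)%N -> q ^+ k != 1.
Proof.
move=> k0; rewrite qvarX -tofrac1 tofrac_eq; apply/eqP => /(congr1 (size \o val)).
by rewrite /= size_polyXn size_poly1; case: k k0.
Qed.

Lemma one_subqE k : 1 - q ^+ k = embed (1 - 'X^k).
Proof. by rewrite qvarX /embed tofracB tofrac1. Qed.

Lemma loc_q k : loc 0 (q ^+ k).
Proof. by rewrite qvarX; exact: loc_embed. Qed.

Lemma loc_qV k : loc 0 (q ^+ k)^-1.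
Proof.
rewrite qvarX; apply: loc_embedV; rewrite /zeval map_polyXn hornerXn expf_neq0 //.
apply: contraTneq (prim_order_gt0 prim_z) => z0.
have := prim_expr_order prim_z; rewrite z0 expr0n; case: (n) => //= m.
by move/eqP; rewrite eq_sym oner_eq0.
Qed.

(** z^k = 1 exactly when n divides k; this separates the units 1 - q^k from those divisible by
    Phi_n. *)
Lemma loc_one_subqV k : ~~ (n %| k)%N -> loc 0 (1 - q ^+ k)^-1.
Proof.
move=> nk; rewrite one_subqE; apply: loc_embedV.
by rewrite zeval1BX subr_eq0 eq_sym -(prim_order_dvd prim_z).
Qed.

Lemma loc1_one_subq k : (n %| k)%N -> loc 1 (1 - q ^+ k).
Proof.
rewrite (prim_order_dvd prim_z) => /eqP zk; rewrite one_subqE.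
have [N ->] : divides Phi (1 - 'X^k).
  by apply: divides_Phi; rewrite zeval1BX zk subrr.
exists N, 1; rewrite expr1 /embed tofrac1 divr1; split=> //.
by rewrite /zeval rmorph1 hornerC oner_neq0.
Qed.

Lemma loc_exp A k : loc 0 A -> loc 0 (A ^+ k).
Proof.
by move=> lA; elim: k => [|k IH]; [exact: loc1 | rewrite exprS; exact: locM lA IH].
Qed.

Lemma loc_prod (I : Type) (r : seq I) (P : pred I) (f : I -> ratfun) :
  (forall i, P i -> loc 0 (f i)) -> loc 0 (\prod_(i <- r | P i) f i).
Proof. by move=> h; elim/big_ind: _ => //; [exact: loc1 | exact: (@locM 0 0)]. Qed.

Lemma loc_qpoch a p k : loc 0 a -> loc 0 p -> loc 0 (qpoch a p k).
Proof.
move=> la lp; apply: loc_prod => i _.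
by apply: locB loc1 _; apply: (locM la); exact: loc_exp.
Qed.

Lemma loc1_qpoch a p k l : loc 0 a -> loc 0 p -> (l < k)%N ->
  loc 1 (1 - a * p ^+ l) -> loc 1 (qpoch a p k).
Proof.
move=> la lp lk h; rewrite /qpoch (bigD1 (Ordinal lk)) //=.
apply: (locM h); apply: loc_prod => i _.
by apply: locB loc1 _; apply: (locM la); exact: loc_exp.
Qed.

Lemma loc_qpochV a b k : (forall i, (i < k)%N -> ~~ (n %| a + b * i)%N) ->
  loc 0 (qpoch (q ^+ a) (q ^+ b) k)^-1.
Proof.
move=> h; rewrite /qpoch -prodfV; apply: loc_prod => i _.
by rewrite -exprM -exprD; apply: loc_one_subqV; exact: h.
Qed.

(** * The interpolation nodes and the congruence modulo Phi_n^3 *)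

Definition ynode i : ratfun := q ^+ (2 * i + 1) + (q ^+ (2 * i + 1))^-1.

Let genq i : generic q (q ^+ (2 * i + 1)) := generic_odd qvar_neq0 qvarX_neq1 i.

Lemma generic1 : generic q 1.
Proof.
split=> [|k k0|k]; first exact: oner_neq0.
  by rewrite mul1r qvarX_neq1.
by rewrite eq_sym qvarX_neq1.
Qed.

Lemma ynodeB i j : (i <= j)%N -> ynode i - ynode j =
  - ((1 - q ^+ (2 * (j - i))) * (1 - q ^+ (2 * (i + j + 1))) / q ^+ (2 * j + 1)).
Proof.
move=> ij; rewrite /ynode.
have -> : q ^+ (2 * j + 1) = q ^+ (2 * i + 1) * q ^+ (2 * (j - i)).
  by rewrite -exprD; congr (_ ^+ _); lia.
have -> : q ^+ (2 * (i + j + 1)) = q ^+ (2 * i + 1) ^+ 2 * q ^+ (2 * (j - i)).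
  by rewrite -exprM -exprD; congr (_ ^+ _); lia.
have := expf_neq0 (2 * i + 1) qvar_neq0; have := expf_neq0 (2 * (j - i)) qvar_neq0.
by move=> d0 w0; rewrite (inv_sum_sub w0 d0).
Qed.

Lemma loc_ynode i : loc 0 (ynode i).
Proof. by apply: locD; [exact: loc_q | exact: loc_qV]. Qed.

Variable K : nat.
Hypothesis nK : n = (2 * K + 1)%N.

(** In the product formula [ynodeB] the exponents are 2 (j - i) and 2 (i + j + 1). As n is odd and
    both j - i and i + j + 1 lie strictly between 0 and n, n divides neither. *)
Lemma ynodeB_unit i j : (i < j <= K)%N ->
  ynode i != ynode j /\ loc 0 (ynode i - ynode j)^-1.
Proof.
move=> /andP[ij jK].
have n1 : ~~ (n %| 2 * (j - i))%N.
  by apply/negP => /dvdn_leq; rewrite muln_gt0 subn_gt0 ij /= => /(_ isT); lia.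
have n2 : ~~ (n %| 2 * (i + j + 1))%N.
  rewrite Gauss_dvdr; last by rewrite nK coprimen2 oddD oddM.
  by apply/negP => /dvdn_leq; rewrite addn1 => /(_ isT); lia.
have u k : ~~ (n %| k)%N -> 1 - q ^+ k != 0.
  move=> nk; rewrite subr_eq0 eq_sym qvarX_neq1 //.
  by case: k nk => //; rewrite dvdn0.
rewrite -subr_eq0 ynodeB 1?ltnW //; split.
  by rewrite oppr_eq0 !mulf_neq0 ?invr_neq0 ?u ?expf_neq0 ?qvar_neq0.
rewrite invrN !invfM invrK; apply: locN; apply: (@locM 0 0); last exact: loc_q.
by apply: (@locM 0 0); apply: loc_one_subqV.
Qed.

Lemma loc1_yden i : (i < K)%N -> loc 1 (yden q K).[ynode i].
Proof.
move=> iK; have [x0 _ _] := genq i.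
rewrite /yden /ynode horner_ypoch //.
set x := q ^+ (2 * i + 1) in x0 *.
have l1 : loc 0 (x * q ^+ 2) by apply: (@locM 0 0); exact: loc_q.
have l2 : loc 0 (q ^+ 2 / x) by apply: (@locM 0 0); [exact: loc_q | exact: loc_qV].
have l4 := loc_q 4.
(* One factor equals 1 - q^n: either x q^(2+4l) = q^n in the first symbol, or q^(2+4l) / x = q^n in
   the second. *)
have [[l e]|[l e]] := two_mod4 (ltnW iK).
- apply: (@locM 1 0); last exact: loc_qpoch.
  apply: (@loc1_qpoch _ _ _ l) => //; first by lia.
  by rewrite /x -exprM -!exprD; apply: loc1_one_subq; rewrite (_ : addn _ _ = n) //; lia.
apply: (@locM 0 1); first exact: loc_qpoch.
apply: (@loc1_qpoch _ _ _ l) => //; first by lia.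
rewrite -mulrA [x^-1 * _]mulrC mulrA -exprM -exprD.
rewrite (_ : 2 + 4 * l = n + (2 * i + 1))%N; last by lia.
by rewrite exprD mulfK //; apply: loc1_one_subq.
Qed.

(** The denominator has factors 1 - q^(4(i+1)) with i + 1 <= K < n; n being odd, all are units. *)
Lemma loc_value m : (m <= K)%N ->
  loc 0 (- (qpoch (q ^+ 2) (q ^+ 4) m / qpoch (q ^+ 4) (q ^+ 4) m) * q ^+ m).
Proof.
move=> mK; apply: (@locM 0 0); last exact: loc_q.
apply: locN; apply: (@locM 0 0); first by apply: loc_qpoch; exact: loc_q.
apply: loc_qpochV => i im; rewrite -mulnS (_ : 4 = 2 ^ 2)%N // Gauss_dvdr.
  by apply/negP => /dvdn_leq => /(_ isT); lia.
by rewrite nK coprimeXr // coprimen2 oddD oddM.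
Qed.

Lemma sum_congruence R : loc 0 R ->
  \sum_(k < K.+1) sterm q (q ^+ n) k = R ->
  (forall i, (i < K)%N -> loc 0 (\sum_(k < K.+1) sterm q (q ^+ (2 * i + 1)) k)) ->
  loc 3 (\sum_(k < K.+1) sterm q 1 k - R).
Proof.
move=> lR SR lS; pose P := ynum q K - R *: yden q K.
have hP x : generic q x -> P.[x + x^-1] =
    (\sum_(k < K.+1) sterm q x k - R) * (yden q K).[x + x^-1].
  by move=> gx; rewrite !hornerE horner_ynum ?qvar_neq0 // mulrBl.
have sP : (size P <= K.+1)%N.
  rewrite (leq_trans (size_polyD _ _)) // size_polyN geq_max size_ynum /=.
  by rewrite (leq_trans (size_scale_leq _ _)) // size_ypoch.
(* [ynode K] is the node of q^n, where P vanishes because R is the value of the sum there. Hence P =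
   T (y - [ynode K]) with T of size at most K. *)
have [T sT eT] := newton_step P (ynode K).
have P0 : P.[ynode K] = 0.
  by rewrite /ynode hP; [rewrite -nK SR subrr mul0r | exact: genq].
have eP y : P.[y] = T.[y] * (y - ynode K) by rewrite {1}eT P0 !hornerE.
(* The point 1 + 1^-1 is y at x = 1, where the sum is the original one; the K remaining nodes
   suffice for T. *)
have lT : loc 1 T.[1 + 1^-1].
  apply: (@interpolation_ideal _ (loc 0) (loc 1) _ _ _ _ K ynode).
  - by move=> a b; apply: (@locM 0 1).
  - exact: locD.
  - exact: locB.
  - exact: loc_zero.
  - by move=> i j /andP[ij jK]; apply: ynodeB_unit; rewrite ij ltnW.
  - move=> i _; apply: locB (loc_ynode _).
    by rewrite invr1; apply: locD; exact: loc1.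
  - by rewrite sT -subn1 leq_subLR add1n.
  (* At node i the sum and R are regular while [yden] brings a factor Phi_n; dividing by the unit
     [ynode i - ynode K] keeps it. *)
  move=> i iK; have [u lu] := ynodeB_unit (i := i) (j := K) ltac:(by rewrite iK /=).
  have -> : T.[ynode i] = (ynode i - ynode K)^-1 * P.[ynode i].
    by rewrite eP mulrC mulfK // subr_eq0.
  apply: (locM lu); rewrite /ynode hP; last exact: genq.
  by apply: (@locM 0 1); [apply: locB => //; exact: lS | exact: loc1_yden].
(* At x = 1, [yden] is the square of (q^2; q^4)_K, whose factors 1 - q^(2(1+2i)) are units because 1
   + 2i < n. *)
have d0 : (yden q K).[1 + 1^-1] != 0 /\ loc 0 (yden q K).[1 + 1^-1]^-1.
  rewrite horner_ypoch ?oner_neq0 // divr1 mul1r invfM; split.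
    rewrite mulf_neq0 //; apply: qpoch_neq0 => i _;
      by rewrite -exprM -exprD qvarX_neq1.
  have l : loc 0 (qpoch (q ^+ 2) (q ^+ 4) K)^-1.
    apply: loc_qpochV => i iK; rewrite (_ : 2 + 4 * i = 2 * (1 + 2 * i))%N; last by lia.
    rewrite Gauss_dvdr; last by rewrite nK coprimen2 oddD oddM.
    by apply/negP => /dvdn_leq; rewrite add1n => /(_ isT); lia.
  exact: (@locM 0 0).
have -> : \sum_(k < K.+1) sterm q 1 k - R =
   T.[1 + 1^-1] * (- (1 - q ^+ n) * (1 - q ^+ n) * (q ^+ n)^-1) * (yden q K).[1 + 1^-1]^-1.
  apply: (mulIf d0.1); rewrite -hP; last exact: generic1.
  rewrite mulfVK ?d0.1 // eP; congr (_ * _); rewrite /ynode -nK invr1.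
  by rewrite (two_sub_inv_sum (expf_neq0 n qvar_neq0)).
(* Of the three powers of Phi_n, T supplies one and (1 - q^n)^2 two. *)
rewrite -[3%N]addn0; apply: locM d0.2; apply: (@locM 1 2) => //.
have l := loc1_one_subq (dvdnn n).
rewrite mulNr; apply: (@locM 2 0); last exact: loc_qV.
by apply: locN; apply: (@locM 1 1).
Qed.

End Local.

(** * The two residue classes of n modulo 4 *)

Theorem theorem1p4 (n : nat) (n_gt0 : (0 < n)%N) (n_odd : odd n) :
  let q := qvar in
  let S := \sum_(0 <= k < ((n - 1) %/ 2).+1)
    qint q (6%:Z * k%:Z - 1) *
    (qpoch q^-1 (q ^+ 4) k * qpoch q^-1 (q ^+ 2) k *
       qpoch q (q ^+ 2) k ^+ 2 /
     (qpoch (q ^+ 2) (q ^+ 2) k * qpoch (q ^+ 4) (q ^+ 4) k *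
       qpoch (q ^+ 2) (q ^+ 4) k ^+ 2)) *
    q ^+ (k ^ 2 + k + 1) in
  let m := ((n - 1) %/ 4)%N in
  (n = 1 %[mod 4] ->
     congr_mod ('Phi_n ^+ 3) S
       (- (qpoch (q ^+ 2) (q ^+ 4) m / qpoch (q ^+ 4) (q ^+ 4) m) * q ^+ m))
  /\
  (n = 3 %[mod 4] -> congr_mod ('Phi_n ^+ 3) S 0).
Proof.
move=> q S m.
have [z prim_z] := C_prim_root_exists n_gt0.
set K := ((n - 1) %/ 2)%N in S *.
have nK : n = (2 * K + 1)%N by rewrite /K; move: n_odd; lia.
have SE : S = \sum_(k < K.+1) sterm q 1 k.
  by rewrite /S big_mkord; apply: eq_bigr => k _; rewrite sterm_at1.
have main R : loc n z 0 R -> \sum_(k < K.+1) sterm q (q ^+ n) k = R ->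
    congr_mod ('Phi_n ^+ 3) S R.
  move=> lR SR; have [|N [D [D0 e]]] := sum_congruence prim_z nK lR SR.
    (* The parity of i decides whether 2i + 1 is 1 or 3 modulo 4, hence which exact evaluation
       applies. *)
    move=> i iK; have [[j ij]|[j ij]] := half_cases i; rewrite ij.
      have -> : (2 * (2 * j) + 1 = 4 * j + 1)%N by rewrite mulnA.
      rewrite (sum_sterm1 qvar_neq0 qvarX_neq1); last by rewrite -ij ltnW.
      by apply: (loc_value prim_z nK); move: iK; rewrite ij; lia.
    have -> : (2 * (2 * j + 1) + 1 = 4 * j + 3)%N by lia.
    rewrite (sum_sterm3 qvar_neq0 qvarX_neq1); first exact: loc_zero.
    by rewrite -ij ltnW.
  have dN : divides ('Phi_n ^+ 3) (N * 'Phi_n ^+ 3) by exists N.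
  have [N' [D' [rf dN']]] := local_reduced_form prim_z D0 dN e.
  by exists N', D'; rewrite SE.
(* The exact evaluation at x = q^n is the claimed right-hand side; K is 2m or 2m + 1 in the two
   cases, so the sum reaches all nonzero terms. *)
split=> hn; apply: main.
- by apply: (loc_value prim_z nK); move: n_gt0; rewrite /m; lia.
- have {1}-> : n = (4 * m + 1)%N by rewrite /m; lia.
  by apply: (sum_sterm1 qvar_neq0 qvarX_neq1); rewrite /m /K; lia.
- exact: loc_zero.
have {1}-> : n = (4 * m + 3)%N by rewrite /m; lia.
by apply: (sum_sterm3 qvar_neq0 qvarX_neq1); rewrite /m /K; lia.
Qed.
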